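(* Let $G$ be a finite graph (loopless, multiple edges allowed), let $m$ be a positive integer, and let $F$ be a factor of $G$ and $T$ an $m$-tree-connected factor of $G$. Let $A=\{v\in V(G): d_F(v)\le m\}$, and suppose that $F\setminus E(T)$ is a bipartite graph with bipartition $(A, V(G)\setminus A)$. Let $M$ be a spanning subgraph of $F\setminus E(T)$ such that for each $v\in V(G)\setminus A$, $d_M(v)+d_{F\cap T}(v)\ge m$. Then $G$ has an $m$-tree-connected factor $H$ containing all edges of $F\setminus E(M)$ such that for each vertex $v$, $$d_F(v)\le d_H(v)\le d_T(v)+\max\{0,d_F(v)-m\}.$$
   Context: Graphs have no loops but may have multiple edges. A factor is a spanning subgraph; $d_X(v)$ is the number of edges of $X$ incident to $v$. For a subgraph $X$ and an edge set $E$, $X\setminus E$ is the spanning subgraph with edge set $E(X)\setminus E$. $F\cap T$ is the spanning subgraph whose edges are the edges belonging to both $F$ and $T$. A graph is $m$-tree-connected if it contains $m$ edge-disjoint spanning trees. *)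

(* Defs.v *)
From HB Require Import structures.
From mathcomp Require Import all_boot.

Set Implicit Arguments.
Unset Strict Implicit.
Unset Printing Implicit Defensive.

(* Edges are abstract, so distinct edges may have the same ends; ends having
   exactly two elements excludes loops. *)
Record multigraph := Multigraph {
  vert : finType;
  edge : finType;
  ends : edge -> {set vert};
  card_ends : forall e, #|ends e| = 2
}.

Section Factors.
Variable G : multigraph.

(* A factor has all the vertices of G, so it is given by its edge set: below,
   X, S : {set edge G} are factors, and X :\: Y, X :&: Y and \subset are the
   corresponding operations and relation on factors. *)
Implicit Types (X S : {set edge G}) (A B : {set vert G}).

Definition deg X (v : vert G) : nat := #|[set e in X | v \in ends e]|.

Definition adj X : rel (vert G) :=
  fun u v => [exists e in X, ends e == [set u; v]].

Definition connected X : Prop := forall u v : vert G, connect (adj X) u v.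

(* The cycle v_0 e_0 v_1 e_1 ... v_(k-1) e_(k-1) v_0 is encoded by the sequence
   of the pairs (v_i, e_i). The case k = 2 is a pair of parallel edges; k = 1
   would need a loop. *)
Definition is_cycle X (c : seq (vert G * edge G)) : bool :=
  [&& c != [::],
      uniq (unzip1 c),
      uniq (unzip2 c),
      all (fun e => e \in X) (unzip2 c)
    & cycle (fun p q => ends p.2 == [set p.1; q.1]) c].

Definition acyclic X : Prop := forall c, ~~ is_cycle X c.

Definition spanning_tree X S : Prop :=
  [/\ S \subset X, connected S & acyclic S].

Definition tree_connected (m : nat) X : Prop :=
  exists t : 'I_m -> {set edge G},
    (forall i, spanning_tree X (t i)) /\
    (forall i j, i != j -> [disjoint t i & t j]).

Definition bipartition X A B : Prop :=
  [/\ A :|: B = [set: vert G],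
      [disjoint A & B]
    & forall e, e \in X ->
        exists u v, [/\ u \in A, v \in B & ends e = [set u; v]]].

End Factors.

(* Main.v *)
Require Import Defs.
From HB Require Import structures.
From mathcomp Require Import all_boot zify.

Set Implicit Arguments.
Unset Strict Implicit.
Unset Printing Implicit Defensive.

(** Starting from [H = T], repeatedly insert a missing edge [e = uv] of [F],
    with [u] in [A]: since [u] has at most [m] edges of [F], one of which is
    [e], some tree of the packing has no edge of [F] at [u], and [e] can replace
    the first edge of the path from [u] to [v] in that tree. Such an exchange
    raises no degree except that of [v], by at most one, and removes no edge of
    [F]. Do this first for the edges of [F] outside [M], which respects the upper
    bound because [d_M(v) + d_{F n T}(v) >= m]; then, as long as some [v] has
    [d_H(v) < d_F(v)], for an edge of [M] at [v], which respects it because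
    [d_T(v) >= m]. *)

Section Packing.
Variable G : multigraph.
Implicit Types (X Y S H F : {set edge G}) (u v w : vert G) (e f : edge G).

Lemma adj_connect_sym X : connect_sym (adj X).
Proof.
by apply: sym_connect_sym => u v; apply: eq_existsb => e; rewrite setUC.
Qed.

Lemma adj_edge X e u v : e \in X -> ends e = [set u; v] -> adj X u v.
Proof. by move=> eX ee; apply/existsP; exists e; rewrite eX ee eqxx. Qed.

Lemma adjP X u v :
  reflect (exists2 e, e \in X & ends e = [set u; v]) (adj X u v).
Proof.
apply: (iffP existsP) => [[e /andP[eX /eqP ee]]|[e eX ee]]; exists e => //.
by rewrite eX ee eqxx.
Qed.

Lemma connect_adjS X Y : X \subset Y ->
  subrel (connect (adj X)) (connect (adj Y)).
Proof.
move=> /subsetP sXY; apply: connect_sub => u v /adjP[e /sXY eY ee].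
exact/connect1/(adj_edge eY ee).
Qed.

(** The edges of [S] other than [e] survive in [Y], and a step along [e] is replaced by a walk in
    [Y] between its ends. This serves both to delete an edge of a cycle and to exchange an edge. *)
Lemma connected_bypass S Y e u v : connected S -> ends e = [set u; v] ->
  S :\ e \subset Y -> connect (adj Y) u v -> connected Y.
Proof.
move=> cS ee /subsetP sSY uv x y; move: (cS x y).
apply: connect_sub => {}x {}y /adjP[g gS eg].
have [ge|ge] := eqVneq g e; last first.
  by apply/connect1/(adj_edge _ eg)/sSY; rewrite !inE ge gS.
have x_uv : x \in [set u; v] by rewrite -ee -ge eg !inE eqxx.
have y_uv : y \in [set u; v] by rewrite -ee -ge eg !inE eqxx orbT.
have vu : connect (adj Y) v u by rewrite adj_connect_sym.
by case/set2P: x_uv => ->; case/set2P: y_uv => ->.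
Qed.

(** The walk is in the format of [is_cycle]; the last pair [q] contributes only its vertex, so its
    edge need not lie in [Y]. *)
Lemma connect_walk Y (p q : vert G * edge G) s :
  path (fun p q => ends p.2 == [set p.1; q.1]) p (rcons s q) ->
  all (fun e => e \in Y) (unzip2 (p :: s)) -> connect (adj Y) p.1 q.1.
Proof.
elim: s p => [|r s IHs] p /=.
  by case/andP=> /eqP ep _ /andP[pY _]; apply/connect1/(adj_edge pY).
case/andP=> /eqP ep pth /andP[pY sY].
exact: connect_trans (connect1 (adj_edge pY ep)) (IHs r pth sY).
Qed.

(** An edge of a cycle is bypassed by the rest of the cycle, so it could be deleted; a cycle of
    length one would be a loop. *)
Lemma minimal_connected_acyclic S : connected S ->
  (forall e, e \in S -> ~ connected (S :\ e)) -> acyclic S.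
Proof.
move=> cS minS [|[v0 e0] [|[v1 e1] c]] //; apply/negP.
  case/and5P=> _ _ _ _ /= /andP[/eqP e00 _].
  by have := card_ends e0; rewrite e00 setUid cards1.
case/and5P=> _ _ /= /andP[e0c _] /andP[e0S cS'] /andP[/eqP e01 pth].
apply: (minS _ e0S); apply: (connected_bypass cS e01 (subxx _)).
rewrite adj_connect_sym; apply: (connect_walk (p := (v1, e1)) pth).
have {}cS' : all (fun e => e \in S) (unzip2 ((v1, e1) :: c)) by [].
apply/allP => g gc; rewrite !inE (allP cS' _ gc) andbT.
by apply: contraNneq e0c => <-.
Qed.

Lemma connected_spanning_tree S : connected S ->
  exists S' : {set edge G}, spanning_tree S S'.
Proof.
pose p X := [forall u, forall v, connect (adj X) u v].
have pP X : reflect (connected X) (p X) by apply: 'forall_forallP.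
move=> /pP/minset_exists[S' /minsetP[/pP cS' minS'] sS'S].
exists S'; split=> //; apply: minimal_connected_acyclic => // e eS' /pP.
move=> /minS'/(_ (subD1set S' e)) eqS'.
by move: eS'; rewrite -eqS' !inE eqxx.
Qed.

(** Acyclicity is dropped: an exchange then has to preserve connectedness only, and trees are
    recovered inside the connected sets at the end. *)
Definition packing m X := exists t : 'I_m -> {set edge G},
  [/\ forall i, t i \subset X, forall i, connected (t i)
    & forall i j, i != j -> [disjoint t i & t j]].

Lemma tree_connectedP m X : tree_connected m X <-> packing m X.
Proof.
split=> -[t]; first by case=> tX dt; exists t; split=> // i; case: (tX i).
case=> tX ct dt.
have /fin_all_exists[t' t'P] i := connected_spanning_tree (ct i).
exists t'; split=> [i|i j ij]; first have [st ct' at'] := t'P i.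
  by split=> //; apply: subset_trans st (tX i).
have [[si _ _] [sj _ _]] := (t'P i, t'P j).
exact: disjointWl si (disjointWr sj (dt _ _ ij)).
Qed.

(** Otherwise choosing an edge of [Y] in each [t i] would inject ['I_m] into [Y]. *)
Lemma disjoint_from_packing m (t : 'I_m -> {set edge G}) Y :
  (forall i j, i != j -> [disjoint t i & t j]) -> #|Y| < m ->
  exists i, [disjoint t i & Y].
Proof.
move=> dt ltYm; apply/existsP; apply: contraLR ltYm => /existsPn tY.
have /fin_all_exists[g gP] i : exists e, (e \in t i) && (e \in Y).
  by have /pred0Pn[e] := tY i; exists e.
rewrite -leqNgt -[m]card_ord -(card_imset _ (_ : injective g)).
  by apply/subset_leq_card/subsetP => _ /imsetP[i _ ->]; case/andP: (gP i).
move=> i j gij; apply/eqP; apply: contraT => /dt/pred0P/(_ (g i)) /=.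
by rewrite {2}gij; case/andP: (gP i) => ->; case/andP: (gP j) => ->.
Qed.

(** A path without repeated vertices never returns to [u], whereas [f] is incident to [u]; hence the
    rest of the path avoids [f]. *)
Lemma connected_first_edge S u v : connected S -> u != v ->
  exists f w, [/\ f \in S, ends f = [set u; w]
                & connect (adj (S :\ f)) w v].
Proof.
move=> cS uv; have /connectP[p0 pth0 ev] := cS u v.
case/shortenP: pth0 ev => -[|w p] /= pth.
  by move=> _ _ euv; rewrite euv eqxx in uv.
move=> /andP[up _] _ ev; case/andP: pth => /adjP[f fS ef] pth.
exists f, w; split=> //; apply/connectP; exists p => //.
apply: (@sub_in_path _ (mem (w :: p))) pth; last exact/allP.
move=> x y xp yp /adjP[g gS eg]; apply: (adj_edge _ eg).
rewrite !inE gS andbT; apply: contraNneq up => gf.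
have : u \in [set x; y] by rewrite -eg gf ef !inE eqxx.
by case/set2P=> ->.
Qed.

Lemma packing_deg m X u v : packing m X -> u != v -> m <= deg X u.
Proof.
case=> t [tX ct dt] uv; rewrite leqNgt; apply/negP.
case/(disjoint_from_packing dt)=> i /pred0P di.
have [f [w [ft ef _]]] := connected_first_edge (ct i) uv.
by have := di f; rewrite /= !inE ft (subsetP (tX i) _ ft) ef !inE eqxx.
Qed.

Lemma packing_exchange m F H e u v : packing m H -> e \in F -> e \notin H ->
  ends e = [set u; v] -> deg F u <= m ->
  exists2 f, packing m (e |: (H :\ f))
           & [/\ f \in H, f \notin F & u \in ends f].
Proof.
case=> t [tH ct dt] eF eH ee degu.
have uv : u != v.
  by apply: contra_eq_neq (card_ends e) => uv; rewrite ee uv setUid cards1.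
(* The inequality is strict because [e] is an edge of [F] at [u] outside [H]. *)
have ltm : #|[set g in F :&: H | u \in ends g]| < m.
  apply: leq_trans degu; apply/proper_card/properP; split.
    by apply/subsetP => g; rewrite !inE => /andP[/andP[-> _] ->].
  by exists e; rewrite !inE ?eF ?(negPf eH) ?andbF // ee !inE eqxx.
have [i /pred0P di] := disjoint_from_packing dt ltm.
have [f [w [ft ef wv]]] := connected_first_edge (ct i) uv.
have fH := subsetP (tH i) _ ft; have uf : u \in ends f by rewrite ef !inE eqxx.
exists f; last first.
  by split=> //; apply: contraFN (di f) => fF; rewrite /= !inE ft fF fH.
exists (fun j => if j == i then e |: (t i :\ f) else t j).
have et j : e \notin t j by apply: contra eH; apply: (subsetP (tH j)).
have tf j : j != i -> f \notin t j.
  by move=> /dt dji; apply: contraL ft => ftj; rewrite (disjointFr dji ftj).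
have dN j : j != i -> [disjoint e |: (t i :\ f) & t j].
  rewrite eq_sym => /dt dij; apply/pred0P => g; rewrite /= !inE.
  have [->|_] := eqVneq g e; first by rewrite (negPf (et j)).
  by apply/negP => /andP[/andP[_ gi]]; rewrite (disjointFr dij gi).
split=> [j|j|j k jk].
- case: eqP => [_|/eqP ji]; first exact/setUS/setSD.
  apply/subsetP => g gt; rewrite !inE (subsetP (tH j) _ gt) andbT.
  by apply/orP; right; apply: contraNneq (tf j ji) => <-.
(* The removed edge [f = uw] is bypassed by the walk from [w] to [v] in [t i] without [f], followed
   by [e]. *)
- case: eqP => // _; apply: (connected_bypass (ct i) ef); first exact: subsetUr.
  rewrite adj_connect_sym; apply: (@connect_trans _ _ v).
    exact: connect_adjS (subsetUr _ _) _ _ wv.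
  by rewrite adj_connect_sym; apply/connect1/(adj_edge _ ee); rewrite !inE eqxx.
- have [ji|ji] := eqVneq j i; have [ki|ki] := eqVneq k i.
  + by rewrite ji ki eqxx in jk.
  + exact: dN.
  + by rewrite disjoint_sym; apply: dN.
  + exact: dt.
Qed.

Lemma degE X v : deg X v = \sum_(e in X) (v \in ends e).
Proof.
rewrite /deg -sum1_card; under eq_bigl do rewrite inE.
by rewrite big_mkcondr; apply: eq_bigr => e _; case: (v \in _).
Qed.

Lemma degU1 X e v : e \notin X -> deg (e |: X) v = (v \in ends e) + deg X v.
Proof. by move=> eX; rewrite !degE big_setU1. Qed.

Lemma degD1 X e v : e \in X -> deg X v = (v \in ends e) + deg (X :\ e) v.
Proof. by move=> eX; rewrite !degE (big_setD1 e). Qed.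

Lemma degID X Y v : deg X v = deg (X :&: Y) v + deg (X :\: Y) v.
Proof. by rewrite !degE (big_setID Y). Qed.

Lemma degS X Y v : X \subset Y -> deg X v <= deg Y v.
Proof.
move=> /subsetP sXY; apply/subset_leq_card/subsetP => e.
by rewrite !inE => /andP[/sXY-> ->].
Qed.

End Packing.

Theorem theorem3p2 (G : multigraph) (m : nat) (F T M : {set edge G})
    (A : {set vert G}) :
  0 < m ->
  tree_connected m T ->
  A = [set v | deg F v <= m] ->
  bipartition (F :\: T) A (~: A) ->
  M \subset F :\: T ->
  (forall v, v \notin A -> m <= deg M v + deg (F :&: T) v) ->
  exists H : {set edge G},
    [/\ tree_connected m H,
        F :\: M \subset H
      & forall v, deg F v <= deg H v <= deg T v + maxn 0 (deg F v - m)].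
Proof.
move=> _ /tree_connectedP pT defA [_ _ bipA] sMFT dMFT.
have AP v : (v \in A) = (deg F v <= m) by rewrite defA inE.
(* On a single vertex, empty sets form a packing; the edge [e] supplies the second vertex. *)
have degm (X : {set edge G}) v e : packing m X -> v \in ends e -> m <= deg X v.
  move=> pX ve; have /card_gt0P[w] : 0 < #|ends e :\ v|.
    by have := card_ends e; rewrite (cardsD1 v) ve; lia.
  by rewrite !inE eq_sym => /andP[vw _]; apply: packing_deg vw.
have deg0 v : deg F v <= 0 \/ exists2 e, e \in F & v \in ends e.
  rewrite leqn0 cards_eq0; have [/eqP|/set0Pn[e]] := boolP (_ == set0).
    by left; apply/eqP.
  by rewrite inE => /andP[]; right; exists e.
(* Outside [A], each missing edge of [F :\: M] reserves one unit of degree for its later insertion.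
   Having [m] on the left avoids truncated subtraction. *)
pose inv (H : {set edge G}) := [/\ packing m H, F :&: T \subset H,
  forall v, v \in A -> deg H v <= deg T v
  & forall v, v \notin A ->
      deg H v + deg ((F :\: M) :\: H) v + m <= deg T v + deg F v].
have invT : inv T.
  split=> // [|v vA]; first exact: subsetIr.
  (* [F] splits into [F :&: T], [M] and the rest of [F :\: T]; that rest is exactly what [T] misses
     of [F :\: M]. *)
  have := dMFT v vA; rewrite (degID F T) (degID (F :\: T) M).
  rewrite (setIidPr sMFT) (setDDl F T M) (setUC T M) -(setDDl F M T); lia.
have missing H e : inv H -> e \in F -> e \notin H -> e \in F :\: T.
  case=> _ sFTH _ _ eF eH; rewrite !inE eF andbT; apply: contra eH => eT.
  by apply: (subsetP sFTH); rewrite inE eF.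
have step H e : inv H -> e \in F -> e \notin H -> exists H' : {set edge G},
  [/\ packing m H', F :&: H \subset H', e \in H',
      forall v, v \in A -> deg H' v <= deg H v
    & forall v, v \notin A -> deg H' v <= deg H v + (v \in ends e)].
  move=> invH eF eH; have [pH _ _ _] := invH.
  have eFT := missing H e invH eF eH.
  have [u [v0 [uA v0A ee]]] := bipA e eFT.
  rewrite AP in uA.
  have [f pH' [fH fF uf]] := packing_exchange pH eF eH ee uA.
  have degH' v : deg (e |: (H :\ f)) v + (v \in ends f)
               = (v \in ends e) + deg H v.
    by rewrite degU1 ?(degD1 v fH) ?inE ?(negPf eH) ?andbF //; lia.
  exists (e |: (H :\ f)); split=> //.
  - apply/subsetP => g; rewrite !inE => /andP[gF ->]; rewrite andbT.
    by apply/orP; right; apply: contraNneq fF => <-.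
  - by rewrite !inE eqxx.
  (* In [A] only [u] gains [e], and there the loss of [f] compensates. *)
  - move=> v vA; have := degH' v; rewrite ee !inE.
    have [->|_] := eqVneq v u; first by rewrite uf; lia.
    have [vv0|_] /= := eqVneq v v0; last lia.
    by move: v0A; rewrite -vv0 inE vA.
  - by move=> v _; have := degH' v; lia.
suff loop n H : #|F :\: H| < n -> inv H -> exists H' : {set edge G},
    [/\ inv H', F :\: M \subset H'
      & forall v, v \notin A -> deg F v <= deg H' v].
  have [H [[pH _ HA HnA] sFMH lbH]] := loop _ T (ltnSn _) invT.
  exists H; split=> // [|v]; first exact/tree_connectedP.
  have [vA|vA] := boolP (v \in A); apply/andP; split.
  - have [|[e eF ve]] := deg0 v; first lia.
    by rewrite AP in vA; apply: leq_trans vA (degm _ _ e pH ve).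
  - by apply: leq_trans (HA v vA) (leq_addr _ _).
  - exact: lbH.
  (* Here [m < deg F v], so the subtraction is exact. *)
  - by have := HnA v vA; rewrite AP in vA; lia.
elim: n H => // n IHn H; rewrite ltnS => leFH invH.
have [pH sFTH HA HnA] := invH.
have progress (H' : {set edge G}) e : e \in F -> e \notin H -> e \in H' -> F :&: H \subset H' ->
    #|F :\: H'| < n /\ F :&: T \subset H'.
  move=> eF eH eH' sH; split; last first.
    by apply: subset_trans sH; rewrite subsetI subsetIl.
  apply: leq_trans leFH; apply/proper_card/properP; split.
    apply/subsetP => g; rewrite !inE => /andP[gH' gF]; rewrite gF andbT.
    by apply: contra gH' => gH; apply: (subsetP sH); rewrite inE gF.
  by exists e; rewrite !inE ?eF ?eH ?eH'.
(* First phase: the degree gained at the end of [e] outside [A] is paid for by [e] leaving the set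
   of missing edges. *)
have [sFMH|/subsetPn[e eFM eH]] := boolP (F :\: M \subset H); last first.
  have eF : e \in F by move: eFM; rewrite inE => /andP[].
  have [H' [pH' sH eH' H'A H'nA]] := step H e invH eF eH.
  have [ltn sFT] := progress H' e eF eH eH' sH.
  apply: (IHn H') => //; split=> // v vA.
    exact: leq_trans (H'A v vA) (HA v vA).
  have := HnA v vA; have := H'nA v vA.
  have eFMH : e \in F :\: M :\: H by rewrite inE eH.
  rewrite (degD1 v eFMH).
  have : deg (F :\: M :\: H') v <= deg (F :\: M :\: H :\ e) v.
    apply/degS/subsetP => g; rewrite !inE => /and3P[gH' gM gF].
    rewrite gM gF !andbT; apply/andP; split.
      by apply: contraNneq gH' => ->.
    by apply: contra gH' => gH; apply: (subsetP sH); rewrite inE gF.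
  lia.
(* Second phase: nothing of [F :\: M] is missing, but a vertex outside [A] may still be short of
   degree. *)
have [/existsP[v1 /andP[v1A lt1]]|/existsPn noV] :=
    boolP [exists v, (v \notin A) && (deg H v < deg F v)]; last first.
  exists H; split=> // v vA; have := noV v; rewrite vA /=; lia.
have /subsetPn[e] :
    ~~ ([set e in F | v1 \in ends e] \subset [set e in H | v1 \in ends e]).
  by apply: contraL lt1 => /subset_leq_card; rewrite -leqNgt.
rewrite !inE => /andP[eF v1e]; rewrite v1e andbT => eH.
have [H' [pH' sH eH' H'A H'nA]] := step H e invH eF eH.
have [ltn sFT] := progress H' e eF eH eH' sH.
apply: (IHn H') => //; split=> // v vA.
  exact: leq_trans (H'A v vA) (HA v vA).
have := H'nA v vA; have := HnA v vA.
have -> : deg (F :\: M :\: H') v = 0.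
  apply/eqP; rewrite cards_eq0 -subset0; apply/subsetP => g.
  rewrite !inE => /andP[/and3P[gH' gM gF] _]; case/negP: gH'.
  by apply: (subsetP sH); rewrite inE gF (subsetP sFMH) // inE gM.
have [ve|_] := boolP (v \in ends e); last by lia.
(* The other end of [e] is in [A], so outside [A] only [v1] can grow; as [deg H v1 < deg F v1] and
   [m <= deg T v1], one more edge respects the bound. *)
suff -> : v = v1 by have := degm _ _ e pT v1e; lia.
have [x [y [xA _ ee]]] := bipA e (missing H e invH eF eH).
move: ve v1e; rewrite ee !inE.
have [vx|_] := eqVneq v x; first by rewrite vx xA in vA.
have [v1x|_] := eqVneq v1 x; first by rewrite v1x xA in v1A.
by move=> /eqP-> /eqP->.
Qed.
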